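(* Let $F$ be a modular function of weight $k$ on some congruence subgroup of $\Gamma$, let $h$ be a modular function (of weight $0$), write $F(\tau)=\sum_{n\ge 0}u(n)h(\tau)^n$ for $\Im(\tau)$ sufficiently large, where $(u(n))_{n\ge0}$ is a sequence satisfying a polynomial recurrence relation (such a sequence exists by the theorem recalled in the context), and finally set $$G^*(\tau)=\frac{D(F)/F}{D(h)/h}(\tau)-\frac{k}{4\pi\,\Im(\tau)\,D(h)/h},$$ which is nonholomorphic but modular of weight $0$. We have the following general formula, which can be considered as a formula for $1/\pi$: $$\sum_{n\ge 0}\bigl(n-G^*(\tau)\bigr)\,u(n)\,h(\tau)^n=\frac{k}{4\pi\,\Im(\tau)}\,\frac{F}{D(h)/h}(\tau).$$
   Context: $\Gamma=\mathrm{SL}_2(\mathbb{Z})$ is the full modular group, $\tau$ is a variable in the complex upper half-plane with imaginary part $\Im(\tau)$, $q=e^{2\pi i\tau}$, and $D$ is the differential operator $D=\frac{1}{2\pi i}\frac{d}{d\tau}=q\frac{d}{dq}$; in the definition of $G^*$ and in the formula, $D(h)/h$ is evaluated at $\tau$. Modular of weight $k$ on a subgroup of $\Gamma$ refers to the usual transformation law $F\left(\frac{a\tau+b}{c\tau+d}\right)=(c\tau+d)^kF(\tau)$ for all $\begin{pmatrix}a&b\\c&d\end{pmatrix}$ in the subgroup. The theorem underlying the expansion: any modular form (or function) $F$ of weight $k$ (say on a congruence subgroup of $\Gamma$), expressed locally in terms of a modular function $h$ of weight $0$, is a solution of a linear differential equation of order $k+1$ with algebraic coefficients, which can be explicitly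 constructed (and if $h$ is a Hauptmodul, the coefficients can be chosen to be polynomials); equivalently, as the paper states it, there exists a sequence $u(n)$ satisfying a polynomial recurrence relation such that $F(\tau)=\sum_{n\ge0}u(n)h(\tau)^n$ for $\Im(\tau)$ sufficiently large. *)

(* Defs.v *)
From Stdlib Require Export Reals ZArith List.
From Coquelicot Require Export Coquelicot.

Open Scope R_scope.

Definition upper (tau : C) : Prop := 0 < Im tau.

Definition Cexp (z : C) : C :=
  (exp (Re z) * cos (Im z), exp (Re z) * sin (Im z)).

Definition CpowZ (z : C) (k : Z) : C :=
  match k with
  | Z0 => RtoC 1
  | Zpos p => Cpow z (Pos.to_nat p)
  | Zneg p => Cinv (Cpow z (Pos.to_nat p))
  end.

Record mat2 : Set := Mat2 { ma : Z; mb : Z; mc : Z; md : Z }.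

Definition SL2Z (g : mat2) : Prop := (ma g * md g - mb g * mc g = 1)%Z.

Definition mat2_one : mat2 := Mat2 1 0 0 1.

Definition mat2_mul (g g' : mat2) : mat2 :=
  Mat2 (ma g * ma g' + mb g * mc g') (ma g * mb g' + mb g * md g')
       (mc g * ma g' + md g * mc g') (mc g * mb g' + md g * md g').

(* The adjugate, which is the inverse on SL_2(Z). *)
Definition mat2_inv (g : mat2) : mat2 :=
  Mat2 (md g) (- mb g) (- mc g) (ma g).

Definition principal_congruence (N : Z) (g : mat2) : Prop :=
  SL2Z g /\ (N | ma g - 1)%Z /\ (N | mb g)%Z /\ (N | mc g)%Z /\ (N | md g - 1)%Z.

Record congruence_subgroup (G : mat2 -> Prop) : Prop := {
  congr_SL2Z : forall g, G g -> SL2Z g;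
  congr_one : G mat2_one;
  congr_mul : forall g g', G g -> G g' -> G (mat2_mul g g');
  congr_inv : forall g, G g -> G (mat2_inv g);
  congr_level : exists N : Z, (0 < N)%Z /\ forall g, principal_congruence N g -> G g
}.

Definition autom (g : mat2) (tau : C) : C :=
  (RtoC (IZR (mc g)) * tau + RtoC (IZR (md g)))%C.

Definition moebius (g : mat2) (tau : C) : C :=
  ((RtoC (IZR (ma g)) * tau + RtoC (IZR (mb g))) / autom g tau)%C.

Definition holomorphic_at (f : C -> C) (z : C) : Prop :=
  locally z (fun w : C => ex_derive (K := C_AbsRing) (V := C_NormedModule) f w).

(* Laurent expansion with finite principal part on a punctured neighbourhood;
   the value of [f] at [z] itself is irrelevant. *)
Definition meromorphic_at (f : C -> C) (z : C) : Prop :=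
  exists (m : nat) (a : nat -> C),
    locally' z (fun w : C =>
      is_pseries (K := C_AbsRing) (V := C_NormedModule)
        a (w - z)%C ((w - z) ^ m * f w)%C).

(* Meromorphic functions are total functions whose values at poles carry no
   meaning, so the transformation law is imposed only where the function is
   defined, as described by [dom]. *)
Definition modular_law (dom : C -> Prop) (k : Z) (G : mat2 -> Prop)
    (f : C -> C) : Prop :=
  forall (g : mat2) (tau : C), G g -> upper tau ->
    dom tau -> dom (moebius g tau) ->
    f (moebius g tau) = (CpowZ (autom g tau) k * f tau)%C.

Definition slash (k : Z) (g : mat2) (f : C -> C) (tau : C) : C :=
  (CpowZ (autom g tau) (- k) * f (moebius g tau))%C.

Definition q_root (N : nat) (tau : C) : C :=
  Cexp (RtoC 2 * RtoC PI * Ci * tau / RtoC (INR N))%C.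

(* At every cusp, f|_k g is a Laurent series in exp(2 i pi tau / N) with finite
   principal part, valid for Im(tau) large. *)
Definition meromorphic_at_cusps (k : Z) (f : C -> C) : Prop :=
  forall g : mat2, SL2Z g ->
    exists (N m : nat) (a : nat -> C) (Y : R),
      (0 < N)%nat /\
      forall tau : C, upper tau -> Y < Im tau ->
        is_pseries (K := C_AbsRing) (V := C_NormedModule)
          a (q_root N tau) (q_root N tau ^ m * slash k g f tau)%C.

Record modular_function (k : Z) (G : mat2 -> Prop) (f : C -> C) : Prop := {
  modular_meromorphic : forall tau, upper tau -> meromorphic_at f tau;
  modular_transform : modular_law (holomorphic_at f) k G f;
  modular_cusps : meromorphic_at_cusps k f
}.

(* [p] lists the coefficients of a polynomial, constant term first. *)
Definition poly_eval (p : list C) (x : C) : C :=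
  fold_right (fun c v => (c + x * v)%C) (RtoC 0) p.

Definition polynomial_recurrence (u : nat -> C) : Prop :=
  exists (r : nat) (p : nat -> list C),
    (exists c : C, In c (p r) /\ c <> RtoC 0) /\
    forall n : nat,
      sum_n (fun i => (poly_eval (p i) (RtoC (INR n)) * u (n + i)%nat)%C) r
        = RtoC 0.

Definition Dop (f : C -> C) (tau : C) : C :=
  (C_derive f tau / (RtoC 2 * RtoC PI * Ci))%C.

Definition dlog (f : C -> C) (tau : C) : C := (Dop f tau / f tau)%C.

Definition Gstar (k : Z) (F h : C -> C) (tau : C) : C :=
  (dlog F tau / dlog h tau
   - RtoC (IZR k) / (RtoC 4 * RtoC PI * RtoC (Im tau) * dlog h tau))%C.

(* Both derivatives exist and no denominator occurring in [Gstar] vanishes. *)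
Definition Gstar_defined (F h : C -> C) (tau : C) : Prop :=
  holomorphic_at F tau /\ holomorphic_at h tau /\
  F tau <> RtoC 0 /\ h tau <> RtoC 0 /\ Dop h tau <> RtoC 0.

(* Main.v *)
(* Part one: differentiating f(g tau) = (c tau + d)^k f(tau) shows that D(F)/F
   transforms with weight 2 up to the extra term k c / (2 pi i (c tau + d)),
   which the term k / (4 pi Im(tau)) compensates, while D(h)/h has weight 2
   exactly.

   Part two: if G* were complex differentiable at tau, so would be Im(tau),
   which is a quotient of functions built from F, h, their derivatives and G*.

   Part three: since h'(tau) <> 0, some point near tau has a value of h of larger
   modulus than h(tau), and the series converges there; hence h(tau) lies inside
   the open disc of convergence, and sum u(n) h^n may be differentiated termwise,
   which gives sum n u(n) h^n = h F' / h'. *)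
Require Import Defs.
From Stdlib Require Import Lra Lia Classical.

(** * Complex derivatives *)

Notation C_locally := (locally (T := C_UniformSpace)).
Notation C_is_derive := (is_derive (K := C_AbsRing) (V := C_NormedModule)).
Notation C_ex_derive := (ex_derive (K := C_AbsRing) (V := C_NormedModule)).
Notation C_is_series := (is_series (K := C_AbsRing) (V := C_NormedModule)).
Notation C_is_pseries := (is_pseries (K := C_AbsRing) (V := C_NormedModule)).

(** The neighbourhoods of [C_UniformSpace] come from the product of two real lines, with square
    balls. Discs generate the same filter, so all later estimates can be made with [Cmod]. *)
Lemma C_locally_Cmod (z : C) (P : C -> Prop) :
  C_locally z P <->
  exists d : posreal, forall w : C, Cmod (w - z) < d -> P w.
Proof.
  split.
  - intros H. apply locally_C in H. destruct H as [d Hd].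
    exists d. intros w Hw. apply Hd, Hw.
  - intros [d Hd]. apply locally_C. exists d. intros w Hw. apply Hd, Hw.
Qed.

Lemma C_is_derive_Cmod (f : C -> C) (z l : C) :
  C_is_derive f z l <->
  forall eps : posreal,
    C_locally z (fun w => Cmod (f w - f z - (w - z) * l) <= eps * Cmod (w - z)).
Proof.
  split.
  - intros [_ H] eps. specialize (H z (fun P HP => HP) eps).
    apply locally_C. exact H.
  - intros H. split.
    + apply is_linear_scal_l.
    + intros x Hx eps.
      rewrite <- (is_filter_lim_locally_unique (V := AbsRing_NormedModule C_AbsRing) z x Hx).
      apply locally_C. exact (H eps).
Qed.

(** The plane carries two normed-module structures, one from the product and one from the ring. The
    product rule and the inner function of the chain rule use the ring structure, hence this
    transfer. *)
Lemma C_is_derive_AbsRing (f : C -> C) (z l : C) :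
  C_is_derive f z l <->
  is_derive (K := C_AbsRing) (V := AbsRing_NormedModule C_AbsRing) f z l.
Proof.
  rewrite C_is_derive_Cmod. split.
  - intros H. split.
    + apply (is_linear_scal_l (K := C_AbsRing) (V := AbsRing_NormedModule C_AbsRing)).
    + intros x Hx eps.
      rewrite <- (is_filter_lim_locally_unique (V := AbsRing_NormedModule C_AbsRing) z x Hx).
      apply locally_C. exact (H eps).
  - intros [_ H] eps. specialize (H z (fun P HP => HP) eps).
    apply locally_C. exact H.
Qed.

Lemma C_is_derive_const (c z : C) : C_is_derive (fun _ => c) z (RtoC 0).
Proof. apply (is_derive_const (K := C_AbsRing) (V := C_NormedModule)). Qed.

Lemma C_is_derive_id (z : C) : C_is_derive (fun w => w) z (RtoC 1).
Proof. apply C_is_derive_AbsRing. apply (is_derive_id (K := C_AbsRing)). Qed.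

Lemma C_is_derive_plus (f g : C -> C) (z df dg : C) :
  C_is_derive f z df -> C_is_derive g z dg ->
  C_is_derive (fun w => f w + g w)%C z (df + dg)%C.
Proof. apply (is_derive_plus (K := C_AbsRing) (V := C_NormedModule)). Qed.

Lemma C_is_derive_minus (f g : C -> C) (z df dg : C) :
  C_is_derive f z df -> C_is_derive g z dg ->
  C_is_derive (fun w => f w - g w)%C z (df - dg)%C.
Proof. apply (is_derive_minus (K := C_AbsRing) (V := C_NormedModule)). Qed.

Lemma C_is_derive_mult (f g : C -> C) (z df dg : C) :
  C_is_derive f z df -> C_is_derive g z dg ->
  C_is_derive (fun w => f w * g w)%C z (df * g z + f z * dg)%C.
Proof.
  rewrite !C_is_derive_AbsRing. intros Hf Hg.
  apply (is_derive_mult (K := C_AbsRing) f g z df dg Hf Hg). apply Cmult_comm.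
Qed.

Lemma C_is_derive_comp (f g : C -> C) (z df dg : C) :
  C_is_derive f (g z) df -> C_is_derive g z dg ->
  C_is_derive (fun w => f (g w)) z (dg * df)%C.
Proof.
  intros Hf Hg. apply C_is_derive_AbsRing in Hg.
  exact (is_derive_comp (K := C_AbsRing) (V := C_NormedModule) f g z df dg Hf Hg).
Qed.

Lemma C_is_derive_ext_loc (f g : C -> C) (z l : C) :
  C_locally z (fun w => f w = g w) -> C_is_derive f z l -> C_is_derive g z l.
Proof.
  intros H. apply (is_derive_ext_loc (K := C_AbsRing) (V := C_NormedModule)).
  apply locally_C, H.
Qed.

Lemma C_is_derive_unique (f : C -> C) (z l l' : C) :
  C_is_derive f z l -> C_is_derive f z l' -> l = l'.
Proof.
  intros H H'. rewrite <- (is_C_derive_unique f z l H).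
  apply is_C_derive_unique, H'.
Qed.

Lemma C_ex_derive_correct (f : C -> C) (z : C) :
  C_ex_derive f z -> C_is_derive f z (C_derive f z).
Proof. apply (C_derive_correct f z z). Qed.

Lemma C_ex_derive_filterlim (f : C -> C) (z : C) :
  C_ex_derive f z -> filterlim f (C_locally z) (C_locally (f z)).
Proof.
  intros H.
  apply (ex_derive_continuous (K := C_AbsRing) (V := C_NormedModule)) in H.
  intros P HP. apply locally_C. exact (H P HP).
Qed.

Lemma C_filterlim_neq (f : C -> C) (z c : C) :
  filterlim f (C_locally z) (C_locally (f z)) -> f z <> c ->
  C_locally z (fun w => f w <> c).
Proof.
  intros Hf Hz. apply (Hf (fun y => y <> c)).
  apply C_locally_Cmod.
  assert (Hd : 0 < Cmod (f z - c)).
  { apply Cmod_gt_0. intros H. apply Hz.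
    replace (f z) with (f z - c + c)%C by ring. rewrite H. ring. }
  exists (mkposreal _ Hd). simpl. intros w Hw ->.
  rewrite <- Cmod_opp in Hw. replace (- (c - f z))%C with (f z - c)%C in Hw by ring.
  lra.
Qed.

Lemma C_is_derive_inv (z : C) :
  z <> RtoC 0 -> C_is_derive Cinv z (- / (z * z))%C.
Proof.
  intros Hz. apply C_is_derive_Cmod. intros eps.
  assert (H0 : 0 < Cmod z) by (apply Cmod_gt_0, Hz).
  apply C_locally_Cmod.
  (* The remainder is exactly [(w - z)^2 / (w z^2)]. The first radius keeps [|w| > |z|/2]; the
     second then makes [|w - z| / (|w| |z|^2)] at most [eps]. *)
  assert (Hd : 0 < Rmin (Cmod z / 2) (eps * Cmod z ^ 3 / 2)).
  { apply Rmin_pos; [lra|]. apply Rdiv_lt_0_compat; [|lra].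
    apply Rmult_lt_0_compat; [apply cond_pos | apply pow_lt, H0]. }
  exists (mkposreal _ Hd). simpl. intros w Hw.
  assert (Hw1 := Rlt_le_trans _ _ _ Hw (Rmin_l _ _)).
  assert (Hw2 := Rlt_le_trans _ _ _ Hw (Rmin_r _ _)).
  assert (Hmw : Cmod z / 2 < Cmod w).
  { assert (H := Cmod_triangle w (z - w)).
    replace (w + (z - w))%C with z in H by ring.
    replace (z - w)%C with (- (w - z))%C in H by ring. rewrite Cmod_opp in H. lra. }
  assert (Hw0 : w <> RtoC 0).
  { apply Cmod_gt_0. lra. }
  replace (/ w - / z - (w - z) * - / (z * z))%C
    with ((w - z) * (w - z) * / (w * (z * z)))%C by (field; auto).
  rewrite !Cmod_mult, Cmod_inv, !Cmod_mult
    by (repeat apply Cmult_neq_0; assumption).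
  set (t := Cmod (w - z)) in *. set (s := Cmod z) in *.
  assert (Ht : 0 <= t) by apply Cmod_ge_0.
  replace (t * t * / (Cmod w * (s * s))) with (t / (Cmod w * (s * s)) * t)
    by (field; split; lra).
  apply Rmult_le_compat_r; [exact Ht|].
  assert (He := cond_pos eps).
  assert (Hp : 0 < Cmod w * (s * s)) by (apply Rmult_lt_0_compat; nra).
  apply Rmult_le_reg_r with (Cmod w * (s * s)); [exact Hp|].
  unfold Rdiv. rewrite Rmult_assoc, Rinv_l, Rmult_1_r by lra.
  apply Rle_trans with (eps * s ^ 3 / 2); [lra|].
  replace (eps * s ^ 3 / 2) with (eps * (s / 2 * (s * s))) by field.
  apply Rmult_le_compat_l; [lra|]. apply Rmult_le_compat_r; nra.
Qed.

Lemma C_is_derive_div (f g : C -> C) (z df dg : C) :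
  C_is_derive f z df -> C_is_derive g z dg -> g z <> RtoC 0 ->
  C_is_derive (fun w => f w / g w)%C z ((df * g z - f z * dg) / (g z * g z))%C.
Proof.
  intros Hf Hg H0.
  replace ((df * g z - f z * dg) / (g z * g z))%C
    with (df * / g z + f z * (dg * - / (g z * g z)))%C by (field; exact H0).
  apply (C_is_derive_mult f (fun w => / g w)%C); [exact Hf|].
  apply (C_is_derive_comp Cinv g); [apply C_is_derive_inv, H0 | exact Hg].
Qed.

(** The factor [f^(n-1)] is written [f^n / f], so that one formula serves [n = 0] and, in the next
    lemma, negative exponents. *)
Lemma C_is_derive_pow (f : C -> C) (z df : C) (n : nat) :
  C_is_derive f z df -> f z <> RtoC 0 ->
  C_is_derive (fun w => f w ^ n)%C z (RtoC (INR n) * f z ^ n / f z * df)%C.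
Proof.
  intros Hf H0. induction n as [|n IH].
  - replace (RtoC (INR 0) * f z ^ 0 / f z * df)%C with (RtoC 0)
      by (simpl; field; exact H0).
    exact (C_is_derive_const (RtoC 1) z).
  - rewrite S_INR, RtoC_plus.
    replace ((RtoC (INR n) + RtoC 1) * f z ^ S n / f z * df)%C
      with (df * f z ^ n + f z * (RtoC (INR n) * f z ^ n / f z * df))%C
      by (rewrite Cpow_S; field; exact H0).
    exact (C_is_derive_mult f (fun w => f w ^ n)%C z _ _ Hf IH).
Qed.

Lemma C_is_derive_powZ (f : C -> C) (z df : C) (k : Z) :
  C_is_derive f z df -> f z <> RtoC 0 ->
  C_is_derive (fun w => CpowZ (f w) k) z
    (RtoC (IZR k) * CpowZ (f z) k / f z * df)%C.
Proof.
  intros Hf H0. destruct k as [|p|p]; unfold CpowZ.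
  - replace (RtoC 0 * RtoC 1 / f z * df)%C with (RtoC 0) by (field; exact H0).
    exact (C_is_derive_const (RtoC 1) z).
  - rewrite <- positive_nat_Z, <- INR_IZR_INZ.
    exact (C_is_derive_pow f z df _ Hf H0).
  - set (n := Pos.to_nat p).
    assert (Hn : (f z ^ n)%C <> RtoC 0) by (apply Cpow_nz, H0).
    replace (IZR (Z.neg p)) with (- INR n)
      by (unfold n; rewrite INR_IZR_INZ, positive_nat_Z, <- opp_IZR; reflexivity).
    rewrite RtoC_opp.
    replace (- RtoC (INR n) * / f z ^ n / f z * df)%C with
      (RtoC (INR n) * f z ^ n / f z * df * - / (f z ^ n * f z ^ n))%C
      by (field; auto).
    apply (C_is_derive_comp Cinv (fun w => f w ^ n)%C).
    + apply C_is_derive_inv, Hn.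
    + exact (C_is_derive_pow f z df _ Hf H0).
Qed.

Lemma Cinv_neq_0 (z : C) : z <> RtoC 0 -> (/ z)%C <> RtoC 0.
Proof.
  intros Hz H. apply C1_nz. rewrite <- (Cinv_l z Hz), H. ring.
Qed.

Lemma CpowZ_neq_0 (z : C) (k : Z) : z <> RtoC 0 -> CpowZ z k <> RtoC 0.
Proof.
  intros Hz. destruct k as [|p|p]; simpl.
  - exact C1_nz.
  - apply Cpow_nz, Hz.
  - apply Cinv_neq_0, Cpow_nz, Hz.
Qed.

(** * Complex power series *)

Lemma C_is_pseries_series (a : nat -> C) (x l : C) :
  C_is_pseries a x l <-> C_is_series (fun n => a n * x ^ n)%C l.
Proof.
  assert (H : forall n, scal (pow_n (K := C_AbsRing) x n) (a n : C_NormedModule)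
                        = (a n * x ^ n)%C).
  { intros n. rewrite (Cmult_comm (a n)). apply (f_equal (fun y => Cmult y (a n))).
    induction n as [|n IH]; [reflexivity|]. rewrite Cpow_S, <- IH. reflexivity. }
  split; apply is_series_ext; intros n; [|symmetry]; apply H.
Qed.

Lemma fst_sum_n (a : nat -> C) (n : nat) :
  fst (sum_n (G := C_AbelianMonoid) a n) = sum_n (fun i => fst (a i)) n.
Proof.
  induction n as [|n IH]; [now rewrite !sum_O|].
  rewrite !sum_Sn, <- IH. reflexivity.
Qed.

Lemma snd_sum_n (a : nat -> C) (n : nat) :
  snd (sum_n (G := C_AbelianMonoid) a n) = sum_n (fun i => snd (a i)) n.
Proof.
  induction n as [|n IH]; [now rewrite !sum_O|].
  rewrite !sum_Sn, <- IH. reflexivity.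
Qed.

Lemma C_is_series_pair (a : nat -> C) (l1 l2 : R) :
  is_series (fun n => fst (a n)) l1 -> is_series (fun n => snd (a n)) l2 ->
  C_is_series a (l1, l2).
Proof.
  intros H1 H2. apply filterlim_locally. intros eps.
  generalize (filter_and _ _ (proj1 (filterlim_locally _ _) H1 eps)
                             (proj1 (filterlim_locally _ _) H2 eps)).
  apply filter_imp. intros n [K1 K2]. split.
  - change (ball l1 eps (fst (sum_n (G := C_AbelianMonoid) a n))).
    now rewrite fst_sum_n.
  - change (ball l2 eps (snd (sum_n (G := C_AbelianMonoid) a n))).
    now rewrite snd_sum_n.
Qed.

(** Real and imaginary parts are both bounded by the modulus, so the real comparison test applies to
    each. *)
Lemma C_ex_series_le (a : nat -> C) (b : nat -> R) :
  (forall n, Cmod (a n) <= b n) -> ex_series b -> exists l, C_is_series a l.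
Proof.
  intros Hab Hb.
  assert (H1 : ex_series (fun n => fst (a n))).
  { apply (ex_series_le (V := R_CompleteNormedModule)) with b; [|exact Hb].
    intros n. eapply Rle_trans; [|apply Hab].
    eapply Rle_trans; [apply Rmax_l|apply Rmax_Cmod]. }
  assert (H2 : ex_series (fun n => snd (a n))).
  { apply (ex_series_le (V := R_CompleteNormedModule)) with b; [|exact Hb].
    intros n. eapply Rle_trans; [|apply Hab].
    eapply Rle_trans; [apply Rmax_r|apply Rmax_Cmod]. }
  destruct H1 as [l1 H1]. destruct H2 as [l2 H2].
  exists (l1, l2). now apply C_is_series_pair.
Qed.

Lemma C_series_Cmod_le (a : nat -> C) (b : nat -> R) (l : C) (B : R) :
  (forall n, Cmod (a n) <= b n) -> C_is_series a l -> is_series b B ->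
  Cmod l <= B.
Proof.
  intros Hab Ha Hb.
  apply (is_lim_seq_le (fun n => Cmod (sum_n (G := C_AbelianMonoid) a n))
           (sum_n b) (Cmod l) B).
  - intros n. induction n as [|n IH].
    + rewrite !sum_O. apply Hab.
    + rewrite !sum_Sn. eapply Rle_trans; [apply Cmod_triangle|].
      apply Rplus_le_compat; [exact IH | apply Hab].
  - intros P HP.
    exact (filterlim_comp _ _ _ _ _ _ _ _ Ha
             (filterlim_norm (V := C_NormedModule) l) P HP).
  - exact Hb.
Qed.

(** * Growth of coefficients and termwise differentiation *)

Lemma C_pseries_coeff_bound (a : nat -> C) (z l : C) :
  C_is_pseries a z l -> exists M, forall n, Cmod (a n) * Cmod z ^ n <= M.
Proof.
  intros H. apply C_is_pseries_series in H.
  destruct (filterlim_bounded (V := C_NormedModule) _ (ex_intro _ l H)) as [M HM].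
  (* Each term is the difference of two consecutive partial sums, both bounded by [M]. *)
  exists (M + M). intros n. rewrite <- Cmod_pow, <- Cmod_mult.
  assert (HM' : forall n, Cmod (sum_n (G := C_AbelianMonoid) (fun n => a n * z ^ n)%C n) <= M).
  { intros m. exact (HM m). }
  assert (H0 : 0 <= M) by (eapply Rle_trans; [apply Cmod_ge_0 | apply (HM' 0%nat)]).
  destruct n as [|n].
  - specialize (HM' 0%nat). rewrite sum_O in HM'. lra.
  - assert (E := HM' (S n)). rewrite sum_Sn in E.
    set (s := sum_n _ n) in E. specialize (HM' n). fold s in HM'.
    replace (a (S n) * z ^ S n)%C with ((s + a (S n) * z ^ S n) + - s)%C by ring.
    eapply Rle_trans; [apply Cmod_triangle|]. rewrite Cmod_opp.
    apply Rplus_le_compat; [exact E | exact HM'].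
Qed.

(** The sum of [s^i (s+d)^(n-1-i)] over [i < n] telescopes to [((s+d)^n - s^n)/d]. The bound
    therefore has no factor [n] and can be summed against a geometric series. *)
Lemma Cpow_diff_bound (x y : C) (s d : R) (n : nat) :
  0 < d -> Cmod x <= s -> Cmod (y - x) <= d ->
  Cmod (y ^ n - x ^ n) <= Cmod (y - x) / d * (s + d) ^ n.
Proof.
  intros Hd Hx Hy.
  assert (Hs : 0 <= s) by (eapply Rle_trans; [apply Cmod_ge_0 | exact Hx]).
  assert (Ht := Cmod_ge_0 (y - x)).
  assert (Hq : 0 <= Cmod (y - x) / d) by (apply Rdiv_le_0_compat; lra).
  induction n as [|n IH].
  - replace (y ^ 0 - x ^ 0)%C with (RtoC 0) by (simpl; ring).
    rewrite Cmod_0. simpl. lra.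
  - replace (y ^ S n - x ^ S n)%C
      with (x * (y ^ n - x ^ n) + (y - x) * y ^ n)%C by (rewrite !Cpow_S; ring).
    eapply Rle_trans; [apply Cmod_triangle|]. rewrite !Cmod_mult, Cmod_pow.
    assert (Hy' : Cmod y <= s + d).
    { replace y with (x + (y - x))%C by ring.
      eapply Rle_trans; [apply Cmod_triangle|]. lra. }
    assert (Hp : Cmod y ^ n <= (s + d) ^ n)
      by (apply pow_incr; split; [apply Cmod_ge_0 | exact Hy']).
    replace (Cmod (y - x) / d * (s + d) ^ S n)
      with (s * (Cmod (y - x) / d * (s + d) ^ n) + Cmod (y - x) * (s + d) ^ n)
      by (simpl; field; lra).
    apply Rplus_le_compat.
    + apply Rmult_le_compat; auto using Cmod_ge_0.
    + apply Rmult_le_compat_l; assumption.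
Qed.

(** The remainder satisfies [R_(n+1) = x R_n + (y - x)(y^n - x^n)]; the last difference is
    controlled by the first-order bound, which supplies the second factor [|y - x|/d]. *)
Lemma Cpow_taylor_bound (x y : C) (s d : R) (n : nat) :
  0 < d -> Cmod x <= s -> Cmod (y - x) <= d ->
  Cmod (y ^ n - x ^ n - (y - x) * (RtoC (INR n) * x ^ Init.Nat.pred n))
    <= (Cmod (y - x) / d) ^ 2 * (s + d) ^ n.
Proof.
  intros Hd Hx Hy.
  assert (Hs : 0 <= s) by (eapply Rle_trans; [apply Cmod_ge_0 | exact Hx]).
  assert (Ht := Cmod_ge_0 (y - x)).
  induction n as [|n IH].
  - replace (y ^ 0 - x ^ 0 - (y - x) * (RtoC (INR 0) * x ^ Init.Nat.pred 0))%C
      with (RtoC 0) by (simpl; ring).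
    rewrite Cmod_0. simpl. assert (H := pow2_ge_0 (Cmod (y - x) / d)). simpl in H. lra.
  - replace (y ^ S n - x ^ S n - (y - x) * (RtoC (INR (S n)) * x ^ Init.Nat.pred (S n)))%C
      with (x * (y ^ n - x ^ n - (y - x) * (RtoC (INR n) * x ^ Init.Nat.pred n))
            + (y - x) * (y ^ n - x ^ n))%C.
    (* The case [n = 0] is separate: the truncation [pred 0 = 0] breaks [x * x^(pred n) = x^n], but
       the coefficient [INR 0] kills that term. *)
    2: { rewrite S_INR, RtoC_plus, !Cpow_S.
         destruct n as [|n]; [simpl; ring|].
         cbn [Init.Nat.pred]. rewrite !Cpow_S. ring. }
    eapply Rle_trans; [apply Cmod_triangle|]. rewrite !Cmod_mult.
    replace ((Cmod (y - x) / d) ^ 2 * (s + d) ^ S n)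
      with (s * ((Cmod (y - x) / d) ^ 2 * (s + d) ^ n)
            + Cmod (y - x) * (Cmod (y - x) / d * (s + d) ^ n))
      by (simpl; field; lra).
    apply Rplus_le_compat.
    + apply Rmult_le_compat; auto using Cmod_ge_0.
    + apply Rmult_le_compat_l; [exact Ht|]. now apply Cpow_diff_bound.
Qed.

(** For [s >= 0], [n s^(n-1) d] is one term of the binomial expansion of [(s + d)^n], whose terms
    are all nonnegative. *)
Lemma Cpow_derive_bound (x : C) (s d : R) (n : nat) :
  0 < d -> Cmod x <= s ->
  INR n * Cmod x ^ Init.Nat.pred n <= (s + d) ^ n / d.
Proof.
  intros Hd Hx. assert (H0 := Cmod_ge_0 x).
  apply Rmult_le_reg_r with d; [exact Hd|].
  unfold Rdiv. rewrite (Rmult_assoc _ (/ d)), Rinv_l, Rmult_1_r by lra.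
  induction n as [|n IH].
  - simpl. lra.
  - assert (Hp : Cmod x ^ n <= (s + d) ^ n) by (apply pow_incr; lra).
    rewrite S_INR. cbn [Init.Nat.pred].
    replace ((INR n + 1) * Cmod x ^ n * d)
      with (Cmod x * (INR n * Cmod x ^ Init.Nat.pred n * d) + d * Cmod x ^ n).
    2: { destruct n as [|n]; [simpl; ring|]. cbn [Init.Nat.pred pow]. ring. }
    change ((s + d) ^ S n) with ((s + d) * (s + d) ^ n).
    assert (Hi : 0 <= (s + d) ^ n) by (apply pow_le; lra).
    apply Rle_trans with (s * (s + d) ^ n + d * (s + d) ^ n); [|lra].
    apply Rplus_le_compat; [|apply Rmult_le_compat_l; lra].
    apply Rle_trans with (Cmod x * (s + d) ^ n).
    + apply Rmult_le_compat_l; assumption.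
    + apply Rmult_le_compat_r; assumption.
Qed.

Definition C_PS_derive (a : nat -> C) (n : nat) : C := (RtoC (INR (S n)) * a (S n))%C.

(* The remainder of order two of y^n at x is at most (|y - x|/d)^2 (|x| + d)^n, so
   the whole estimate reduces to a geometric series of ratio (|x| + d)/|z| < 1. *)
Lemma C_pseries_taylor (a : nat -> C) (z l x : C) :
  C_is_pseries a z l -> Cmod x < Cmod z ->
  exists (L : C) (K d : R),
    0 < d /\ 0 <= K /\
    C_is_pseries (C_PS_derive a) x L /\
    forall y lx ly, Cmod (y - x) <= d ->
      C_is_pseries a x lx -> C_is_pseries a y ly ->
      Cmod (ly - lx - (y - x) * L) <= K * Cmod (y - x) ^ 2.
Proof.
  intros Ha Hx. assert (Hx0 := Cmod_ge_0 x).
  destruct (C_pseries_coeff_bound a z l Ha) as [M HM].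
  assert (HM0 : 0 <= M).
  { eapply Rle_trans; [|apply (HM 0%nat)]. simpl.
    rewrite Rmult_1_r. apply Cmod_ge_0. }
  set (s := Cmod x) in *. set (r := Cmod z) in *.
  (* Half the gap between [|x|] and [|z|]: [s + d] stays below [r], and the coefficient bound at [z]
     becomes [|a n| (s + d)^n <= M q^n]. *)
  set (d := (r - s) / 2). set (q := (s + d) / r).
  assert (Hr : 0 < r) by lra.
  assert (Hd : 0 < d) by (unfold d; lra).
  assert (Hsd : 0 <= s + d < r) by (unfold d; lra).
  assert (Hq : 0 <= q < 1).
  { unfold q. split; [apply Rdiv_le_0_compat; lra|].
    apply Rmult_lt_reg_r with r; [lra|].
    unfold Rdiv. rewrite Rmult_assoc, Rinv_l by lra. lra. }
  assert (Han : forall n, Cmod (a n) * (s + d) ^ n <= M * q ^ n).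
  { intros n. replace ((s + d) ^ n) with (r ^ n * q ^ n).
    - rewrite <- Rmult_assoc. apply Rmult_le_compat_r; [apply pow_le, Hq | apply HM].
    - rewrite <- Rpow_mult_distr. f_equal. unfold q. field. lra. }
  assert (Hgeom : forall c, is_series (fun n => c * q ^ n) (c * / (1 - q))).
  { intros c. apply (is_series_scal (V := R_NormedModule)). apply is_series_geom.
    rewrite Rabs_pos_eq; lra. }
  destruct (C_ex_series_le (fun n => a n * (RtoC (INR n) * x ^ Init.Nat.pred n))%C
              (fun n => M / d * q ^ n)) as [L HL].
  { intros n. rewrite !Cmod_mult, Cmod_pow, Cmod_R, (Rabs_pos_eq _ (pos_INR n)).
    fold s. apply Rle_trans with (Cmod (a n) * ((s + d) ^ n / d)).
    - apply Rmult_le_compat_l; [apply Cmod_ge_0|].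
      apply Cpow_derive_bound; [exact Hd | apply Rle_refl].
    - replace (M / d * q ^ n) with (M * q ^ n * / d) by (field; lra).
      unfold Rdiv. rewrite <- Rmult_assoc. apply Rmult_le_compat_r; [|apply Han].
      left. apply Rinv_0_lt_compat, Hd. }
  { eexists. apply Hgeom. }
  exists L, (M / d ^ 2 * / (1 - q)), d. repeat split; [exact Hd| | |].
  - apply Rmult_le_pos; [apply Rdiv_le_0_compat; [exact HM0 | apply pow_lt, Hd]|].
    left. apply Rinv_0_lt_compat. lra.
  - apply C_is_pseries_series.
    apply (is_series_ext (V := C_NormedModule)
      (fun n => a (S n) * (RtoC (INR (S n)) * x ^ Init.Nat.pred (S n)))%C).
    + intros n. unfold C_PS_derive. cbn [Init.Nat.pred].
      match goal with |- @eq _ ?u ?v => change (@eq C u v) end. ring.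
    (* The series in [HL] starts at index 0 with the coefficient [INR 0], so dropping that term
       leaves the sum [L] unchanged. *)
    + apply (is_series_incr_1 (V := C_NormedModule)
        (fun n => a n * (RtoC (INR n) * x ^ Init.Nat.pred n))%C).
      replace (plus (L : C_NormedModule) _) with L; [exact HL|].
      assert (E : forall u v w : C, u = (u + v * (RtoC 0 * w))%C) by (intros; ring).
      exact (E L (a 0%nat) (x ^ 0)%C).
  - intros y lx ly Hy Hlx Hly.
    apply C_is_pseries_series in Hlx. apply C_is_pseries_series in Hly.
    assert (E := is_series_minus (V := C_NormedModule) _ _ _ _
      (is_series_minus (V := C_NormedModule) _ _ _ _ Hly Hlx)
      (is_series_scal (V := C_NormedModule) (y - x)%C _ _ HL)).
    apply (C_series_Cmod_le _ (fun n => (M * (Cmod (y - x) / d) ^ 2) * q ^ n) _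
             (M * (Cmod (y - x) / d) ^ 2 * / (1 - q))) in E; [| |apply Hgeom].
    + replace (M / d ^ 2 * / (1 - q) * Cmod (y - x) ^ 2)
        with (M * (Cmod (y - x) / d) ^ 2 * / (1 - q)) by (field; lra).
      exact E.
    + intros n.
      change (Cmod (a n * y ^ n + - (a n * x ^ n)
                + - ((y - x) * (a n * (RtoC (INR n) * x ^ Init.Nat.pred n))))
              <= M * (Cmod (y - x) / d) ^ 2 * q ^ n).
      replace (a n * y ^ n + - (a n * x ^ n)
                + - ((y - x) * (a n * (RtoC (INR n) * x ^ Init.Nat.pred n))))%C
        with (a n * (y ^ n - x ^ n - (y - x) * (RtoC (INR n) * x ^ Init.Nat.pred n)))%C
        by ring.
      rewrite Cmod_mult.
      apply Rle_trans with (Cmod (a n) * ((Cmod (y - x) / d) ^ 2 * (s + d) ^ n)).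
      * apply Rmult_le_compat_l; [apply Cmod_ge_0|].
        apply Cpow_taylor_bound; [exact Hd | apply Rle_refl | exact Hy].
      * replace (Cmod (a n) * ((Cmod (y - x) / d) ^ 2 * (s + d) ^ n))
          with ((Cmod (y - x) / d) ^ 2 * (Cmod (a n) * (s + d) ^ n)) by ring.
        replace (M * (Cmod (y - x) / d) ^ 2 * q ^ n)
          with ((Cmod (y - x) / d) ^ 2 * (M * q ^ n)) by ring.
        apply Rmult_le_compat_l; [apply pow2_ge_0 | apply Han].
Qed.

Lemma C_locally_imp (z : C) (P Q : C -> Prop) :
  (forall w, P w -> Q w) -> C_locally z P -> C_locally z Q.
Proof. apply filter_imp. Qed.

Lemma C_locally_and (z : C) (P Q : C -> Prop) :
  C_locally z P -> C_locally z Q -> C_locally z (fun w => P w /\ Q w).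
Proof. apply filter_and. Qed.

Lemma C_locally_ball (z : C) (r : R) :
  0 < r -> C_locally z (fun w => Cmod (w - z) < r).
Proof.
  intros Hr. apply C_locally_Cmod. now exists (mkposreal r Hr).
Qed.

(** The remainder of [F] splits into the second-order remainder of the power series between [h z0]
    and [h w], and [L] times the first-order remainder of [h]. Each part gets half of [eps]. *)
Lemma C_is_derive_pseries_comp (a : nat -> C) (z l : C) (h F : C -> C) (z0 dh : C) :
  C_is_pseries a z l -> Cmod (h z0) < Cmod z -> C_is_derive h z0 dh ->
  C_locally z0 (fun w => C_is_pseries a (h w) (F w)) ->
  exists L : C, C_is_pseries (C_PS_derive a) (h z0) L /\ C_is_derive F z0 (dh * L)%C.
Proof.
  intros Ha Hz Hh HF.
  destruct (C_pseries_taylor a z l (h z0) Ha Hz) as (L & K & d & Hd & HK & HL & HT).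
  exists L. split; [exact HL|]. apply C_is_derive_Cmod. intros eps.
  assert (He := cond_pos eps).
  assert (HL0 := Cmod_ge_0 L). assert (Hdh := Cmod_ge_0 dh).
  (* The bound by 1 makes [|h w - h z0| <= B |w - z0|]; the other bound gives [e1 |L| <= eps/2]. The
     added 1 keeps the denominator positive when [L = 0]. *)
  set (e1 := Rmin 1 (eps / (2 * (Cmod L + 1)))).
  assert (He1 : 0 < e1).
  { apply Rmin_pos; [lra|]. apply Rdiv_lt_0_compat; lra. }
  assert (He1' : e1 * Cmod L <= eps / 2).
  { apply Rle_trans with (eps / (2 * (Cmod L + 1)) * (Cmod L + 1)).
    - apply Rmult_le_compat; [lra | exact HL0 | apply Rmin_r | lra].
    - right. field. lra. }
  set (B := Cmod dh + 1). assert (HB : 1 <= B) by (unfold B; lra).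
  assert (HKB : 0 <= K * B ^ 2) by (apply Rmult_le_pos; [exact HK | apply pow2_ge_0]).
  (* The radius [d / B] puts [h w] within [d] of [h z0], where the Taylor estimate holds; the last
     radius makes [K B^2 |w - z0|] at most [eps/2]. *)
  generalize (C_locally_and _ _ _ HF (C_locally_and _ _ _
    (proj1 (C_is_derive_Cmod h z0 dh) Hh (mkposreal e1 He1))
    (C_locally_and _ _ _
      (C_locally_ball z0 (d / B) ltac:(apply Rdiv_lt_0_compat; lra))
      (C_locally_ball z0 (eps / (2 * (K * B ^ 2 + 1)))
         ltac:(apply Rdiv_lt_0_compat; lra))))).
  apply C_locally_imp. cbn [pos]. intros w (Fw & Hw & Hw1 & Hw2).
  set (t := Cmod (w - z0)) in *. assert (Ht : 0 <= t) by apply Cmod_ge_0.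
  assert (HB' : Cmod (h w - h z0) <= B * t).
  { replace (h w - h z0)%C
      with ((h w - h z0 - (w - z0) * dh) + (w - z0) * dh)%C by ring.
    eapply Rle_trans; [apply Cmod_triangle|]. rewrite (Cmod_mult (w - z0)%C dh). fold t.
    assert (e1 <= 1) by apply Rmin_l.
    assert (e1 * t <= 1 * t) by (apply Rmult_le_compat_r; assumption).
    unfold B. lra. }
  assert (HBt : B * t <= d).
  { apply Rle_trans with (B * (d / B)); [apply Rmult_le_compat_l; lra|].
    right. field. lra. }
  specialize (HT (h w) (F z0) (F w) ltac:(lra) (locally_singleton _ _ HF) Fw).
  replace (F w - F z0 - (w - z0) * (dh * L))%C
    with ((F w - F z0 - (h w - h z0) * L) + (h w - h z0 - (w - z0) * dh) * L)%C by ring.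
  eapply Rle_trans; [apply Cmod_triangle|]. rewrite (Cmod_mult _ L).
  apply Rle_trans with (eps / 2 * t + eps / 2 * t); [|lra].
  apply Rplus_le_compat.
  - eapply Rle_trans; [exact HT|].
    apply Rle_trans with (K * (B * t) ^ 2).
    + apply Rmult_le_compat_l; [exact HK|]. apply pow_incr.
      split; [apply Cmod_ge_0 | exact HB'].
    + replace (K * (B * t) ^ 2) with (K * B ^ 2 * t * t) by ring.
      apply Rmult_le_compat_r; [exact Ht|].
      apply Rle_trans with ((K * B ^ 2 + 1) * (eps / (2 * (K * B ^ 2 + 1)))).
      * apply Rmult_le_compat; lra.
      * right. field. lra.
  - apply Rle_trans with (e1 * t * Cmod L).
    + apply Rmult_le_compat_r; [exact HL0 | exact Hw].
    + replace (e1 * t * Cmod L) with (e1 * Cmod L * t) by ring.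
      apply Rmult_le_compat_r; assumption.
Qed.

(** * Removable singularities and the second derivative *)

(** At [z + t] with small real [t > 0], continuity brings [g] close to [g z], and the Taylor
    estimate at 0 brings it close to [a 0]. *)
Lemma C_pseries_punctured_value (a : nat -> C) (g : C -> C) (z : C) :
  filterlim g (C_locally z) (C_locally (g z)) ->
  C_locally z (fun w : C => w <> z -> C_is_pseries a (w - z)%C (g w)) ->
  g z = a 0%nat.
Proof.
  intros Hg Ha.
  destruct (proj1 (C_locally_Cmod _ _) Ha) as [r Hr]. assert (Hr0 := cond_pos r).
  assert (Hpt : forall t, 0 < t < r ->
    Cmod (z + RtoC t - z) = t /\ C_is_pseries a (z + RtoC t - z)%C (g (z + RtoC t)%C)).
  { intros t Ht.
    assert (E : Cmod (z + RtoC t - z) = t).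
    { replace (z + RtoC t - z)%C with (RtoC t) by ring.
      rewrite Cmod_R. apply Rabs_pos_eq. lra. }
    split; [exact E|]. apply Hr; [lra|].
    intros H. rewrite H in E. replace (z - z)%C with (RtoC 0) in E by ring.
    rewrite Cmod_0 in E. lra. }
  destruct (Hpt (r / 2) ltac:(lra)) as [E1 P1].
  destruct (C_pseries_taylor a _ _ (RtoC 0) P1) as (L & K & d & Hd & HK & _ & HT).
  { rewrite Cmod_0, E1. lra. }
  assert (P0 : C_is_pseries a (RtoC 0) (a 0%nat))
    by apply (is_pseries_0 (V := C_NormedModule)).
  apply NNPP. intros Hne.
  set (e := Cmod (g z - a 0%nat)).
  assert (He : 0 < e).
  { apply Cmod_gt_0. intros H. apply Hne.
    replace (g z) with (g z - a 0%nat + a 0%nat)%C by ring. rewrite H. ring. }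
  assert (Hc : C_locally z (fun w => Cmod (g w - g z) < e / 2))
    by (apply (Hg (fun y => Cmod (y - g z) < e / 2)); apply C_locally_ball; lra).
  destruct (proj1 (C_locally_Cmod _ _) Hc) as [r' Hr']. assert (Hr0' := cond_pos r').
  assert (HL0 := Cmod_ge_0 L).
  (* In order: inside the disc of the expansion, inside the disc where [g] is within [e/2] of [g z],
     inside the range of the Taylor estimate, [t^2 <= t], and finally [K t^2 + t |L| <= e/2].
     Together these give [e < e]. *)
  set (t := Rmin (Rmin (r / 2) (r' / 2)) (Rmin (Rmin d 1) (e / (2 * (Cmod L + K + 1))))).
  assert (Ht : 0 < t).
  { repeat apply Rmin_pos; try lra. apply Rdiv_lt_0_compat; lra. }
  assert (T1 : t <= r / 2) by (eapply Rle_trans; [apply Rmin_l|apply Rmin_l]).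
  assert (T2 : t <= r' / 2) by (eapply Rle_trans; [apply Rmin_l|apply Rmin_r]).
  assert (T3 : t <= d)
    by (eapply Rle_trans; [apply Rmin_r|eapply Rle_trans; [apply Rmin_l|apply Rmin_l]]).
  assert (T4 : t <= 1)
    by (eapply Rle_trans; [apply Rmin_r|eapply Rle_trans; [apply Rmin_l|apply Rmin_r]]).
  assert (T5 : t <= e / (2 * (Cmod L + K + 1)))
    by (eapply Rle_trans; [apply Rmin_r|apply Rmin_r]).
  destruct (Hpt t ltac:(lra)) as [E P].
  specialize (Hr' (z + RtoC t)%C ltac:(lra)).
  replace (z + RtoC t - z)%C with (RtoC t - RtoC 0)%C in E by ring.
  replace (z + RtoC t - z)%C with (RtoC t) in P by ring.
  specialize (HT (RtoC t) _ _ ltac:(lra) P0 P). rewrite E in HT.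
  set (gt := g (z + RtoC t)%C) in *.
  assert (Hle : e <= Cmod (gt - g z) + (K * t ^ 2 + t * Cmod L)).
  { unfold e.
    replace (g z - a 0%nat)%C with (- (gt - g z) +
      ((gt - a 0%nat - (RtoC t - RtoC 0) * L) + (RtoC t - RtoC 0) * L))%C by ring.
    eapply Rle_trans; [apply Cmod_triangle|]. rewrite Cmod_opp.
    apply Rplus_le_compat_l.
    eapply Rle_trans; [apply Cmod_triangle|]. rewrite (Cmod_mult _ L), E. lra. }
  assert (Hle2 : K * t ^ 2 + t * Cmod L <= e / 2).
  { apply Rle_trans with (t * (Cmod L + K + 1)).
    - assert (t * t <= 1 * t) by (apply Rmult_le_compat_r; lra).
      assert (K * (t * t) <= K * (1 * t)) by (apply Rmult_le_compat_l; lra).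
      replace (K * t ^ 2) with (K * (t * t)) by ring. nra.
    - apply Rle_trans with (e / (2 * (Cmod L + K + 1)) * (Cmod L + K + 1)).
      + apply Rmult_le_compat_r; lra.
      + right. field. lra. }
  lra.
Qed.

(** Induction on [m]. For a positive exponent the product is continuous and vanishes at [z], so
    [a 0 = 0] and the series can be divided by [w - z]. For [m = 0] continuity of [f] forces the
    right value at [z] itself. *)
Lemma C_pseries_removable (f : C -> C) (z : C) (m : nat) (a : nat -> C) :
  C_ex_derive f z ->
  C_locally z (fun w : C => w <> z ->
    C_is_pseries a (w - z)%C ((w - z) ^ m * f w)%C) ->
  exists b, C_locally z (fun w => C_is_pseries b (w - z)%C (f w)).
Proof.
  intros Hf. revert a. induction m as [|m IH]; intros a Ha.
  - exists a.
    assert (Ha' : C_locally z (fun w : C => w <> z -> C_is_pseries a (w - z)%C (f w))).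
    { revert Ha. apply C_locally_imp. intros w H Hw. specialize (H Hw).
      replace ((w - z) ^ 0 * f w)%C with (f w) in H
        by (symmetry; apply Cmult_1_l). exact H. }
    assert (E := C_pseries_punctured_value a f z (C_ex_derive_filterlim f z Hf) Ha').
    revert Ha'. apply C_locally_imp. intros w H.
    destruct (classic (w = z)) as [-> | Hw]; [|exact (H Hw)].
    replace (z - z)%C with (RtoC 0) by (symmetry; apply Cplus_opp_r). rewrite E.
    apply (is_pseries_0 (V := C_NormedModule)).
  - assert (E : a 0%nat = RtoC 0).
    { rewrite <- (C_pseries_punctured_value a (fun w => (w - z) ^ S m * f w)%C z).
      - rewrite Cpow_S. ring.
      - apply (C_ex_derive_filterlim (fun w => (w - z) ^ S m * f w)%C).
        destruct Hf as [df Hf].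
        assert (Hid : C_is_derive (fun w => w - z)%C z (RtoC 1 - RtoC 0)%C)
          by (apply (C_is_derive_minus (fun w => w) (fun _ => z));
              [apply C_is_derive_id | apply C_is_derive_const]).
        assert (Hp : forall n, C_ex_derive (fun w => (w - z) ^ n)%C z).
        { intros n. induction n as [|n [dn IHn]].
          - eexists. exact (C_is_derive_const (RtoC 1) z).
          - eexists. exact (C_is_derive_mult _ (fun w => (w - z) ^ n)%C z _ _ Hid IHn). }
        destruct (Hp (S m)) as [dp Hdp].
        eexists. exact (C_is_derive_mult (fun w => (w - z) ^ S m)%C f z _ _ Hdp Hf).
      - exact Ha. }
    apply (IH (PS_decr_1 a)). revert Ha. apply C_locally_imp. intros w H Hw.
    specialize (H Hw).
    assert (Hwz : (w - z)%C <> RtoC 0).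
    { intros H0. apply Hw. replace w with (w - z + z)%C by ring. rewrite H0. ring. }
    assert (H' := is_pseries_decr_1 (V := C_NormedModule) a (w - z)%C (/ (w - z))%C _
                    (Cinv_l _ Hwz) H).
    match type of H' with is_pseries _ _ ?l =>
      replace ((w - z) ^ m * f w)%C with l; [exact H'|] end.
    change (@eq C (/ (w - z) * ((w - z) ^ S m * f w + - a 0%nat))%C
              ((w - z) ^ m * f w)%C).
    rewrite E, Cpow_S. field. exact Hwz.
Qed.

Lemma C_derive_pseries (f : C -> C) (z : C) (b : nat -> C) :
  C_locally z (fun w => C_is_pseries b (w - z)%C (f w)) ->
  C_locally z (fun w => C_ex_derive f w /\
    C_is_pseries (C_PS_derive b) (w - z)%C (C_derive f w)).
Proof.
  intros H. destruct (proj1 (C_locally_Cmod _ _) H) as [d Hd].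
  assert (Hd0 := cond_pos d).
  (* A point of convergence at distance [d/2] places every [w] with [|w - z| < d/2] strictly inside
     the disc of convergence. *)
  assert (E : Cmod (z + RtoC (d / 2) - z) = d / 2).
  { replace (z + RtoC (d / 2) - z)%C with (RtoC (d / 2)) by ring.
    rewrite Cmod_R. apply Rabs_pos_eq. lra. }
  assert (P : C_is_pseries b (z + RtoC (d / 2) - z)%C (f (z + RtoC (d / 2))%C))
    by (apply Hd; lra).
  generalize (C_locally_and _ _ _ (locally_locally _ _ H) (C_locally_ball z (d / 2) ltac:(lra))).
  apply C_locally_imp. intros w [Hw Hwd].
  assert (Hid : C_is_derive (fun w => w - z)%C w (RtoC 1)).
  { replace (RtoC 1) with (RtoC 1 - RtoC 0)%C by ring.
    apply (C_is_derive_minus (fun w => w) (fun _ => z));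
      [apply C_is_derive_id | apply C_is_derive_const]. }
  destruct (C_is_derive_pseries_comp b _ _ (fun w => w - z)%C f w _ P
              ltac:(cbv beta; lra) Hid Hw) as (L & HL & HfL).
  split; [exists (RtoC 1 * L)%C; exact HfL|].
  rewrite (is_C_derive_unique f w _ HfL).
  replace (RtoC 1 * L)%C with L by ring. exact HL.
Qed.

(* [holomorphic_at] only asks for one complex derivative; the Laurent expansion
   supplies the second one without Goursat's theorem. *)
Lemma meromorphic_ex_derive2 (f : C -> C) (z : C) :
  meromorphic_at f z -> holomorphic_at f z -> C_ex_derive (C_derive f) z.
Proof.
  intros (m & a & Ha) Hf.
  destruct (C_pseries_removable f z m a (locally_singleton _ _ Hf) Ha) as [b Hb].
  apply C_derive_pseries in Hb.
  assert (Hb' : C_locally z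
    (fun w => C_is_pseries (C_PS_derive b) (w - z)%C (C_derive f w)))
    by (revert Hb; apply C_locally_imp; tauto).
  apply C_derive_pseries in Hb'. apply (locally_singleton _ _ Hb').
Qed.

(** * Modular transformations *)

Lemma Im_gt_open (z : C) (y : R) :
  y < Im z -> C_locally z (fun w => y < Im w).
Proof.
  intros H. generalize (C_locally_ball z (Im z - y) ltac:(lra)).
  apply C_locally_imp. intros w Hw.
  assert (Hi : Rabs (Im w - Im z) <= Cmod (w - z)).
  { eapply Rle_trans; [apply Rmax_r | apply (Rmax_Cmod (w - z)%C)]. }
  assert (Hi' := Rle_abs (- (Im w - Im z))). rewrite Rabs_Ropp in Hi'. lra.
Qed.

Lemma upper_open (tau : C) : upper tau -> C_locally tau upper.
Proof. apply Im_gt_open. Qed.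

Lemma RtoC_neq_0 (x : R) : x <> 0 -> RtoC x <> RtoC 0.
Proof. intros H E. apply H, RtoC_inj, E. Qed.

Lemma Cconj_RtoC (x : R) : Cconj (RtoC x) = RtoC x.
Proof. unfold Cconj, RtoC. simpl. f_equal. ring. Qed.

(** The imaginary part [c y = 0] with [y > 0] gives [c = 0], then [d = 0], against determinant 1. *)
Lemma autom_neq_0 (g : mat2) (tau : C) :
  SL2Z g -> upper tau -> autom g tau <> RtoC 0.
Proof.
  unfold SL2Z, upper, autom. intros Hg Ht E.
  assert (EI := f_equal Im E). assert (ER := f_equal Re E).
  destruct tau as [x y]. simpl in *.
  assert (Hc : IZR (mc g) = 0) by nra.
  assert (Hd : IZR (md g) = 0) by (rewrite Hc in ER; lra).
  apply eq_IZR in Hc. apply eq_IZR in Hd. rewrite Hc, Hd in Hg. lia.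
Qed.

Lemma SL2Z_det (g : mat2) : SL2Z g ->
  (RtoC (IZR (ma g)) * RtoC (IZR (md g)) - RtoC (IZR (mb g)) * RtoC (IZR (mc g)))%C
    = RtoC 1.
Proof.
  intros Hg. rewrite <- !RtoC_mult, <- RtoC_minus, <- !mult_IZR, <- minus_IZR.
  now rewrite Hg.
Qed.

(** This follows from [z - conj z = 2 i Im z]. It is stated in [C], with [J conj J] in place of
    [|J|^2], so that it can be substituted into rational identities. *)
Lemma Im_moebius (g : mat2) (tau : C) : SL2Z g -> upper tau ->
  RtoC (Im (moebius g tau)) = (RtoC (Im tau) / (autom g tau * Cconj (autom g tau)))%C.
Proof.
  intros Hg Ht. assert (HJ := autom_neq_0 g tau Hg Ht).
  assert (HJ' : Cconj (autom g tau) <> RtoC 0).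
  { apply Cmod_gt_0. rewrite Cmod_conj. apply Cmod_gt_0, HJ. }
  rewrite !im_alt. unfold moebius.
  rewrite Cdiv_conj by exact HJ.
  assert (E : Cconj (autom g tau) =
    (RtoC (IZR (mc g)) * Cconj tau + RtoC (IZR (md g)))%C).
  { unfold autom. rewrite Cplus_conj, Cmult_conj, !Cconj_RtoC. reflexivity. }
  rewrite Cplus_conj, Cmult_conj, !Cconj_RtoC.
  (* Keeping [ad - bc] unevaluated makes the first half a formal identity; the determinant is set to
     1 only in the second half. *)
  transitivity (((RtoC (IZR (ma g)) * RtoC (IZR (md g)) -
     RtoC (IZR (mb g)) * RtoC (IZR (mc g))) * (tau - Cconj tau) / (RtoC 2 * Ci)
     / (autom g tau * Cconj (autom g tau)))%C).
  - rewrite E in HJ' |- *. unfold autom in *. field.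
    repeat split; auto using Ci_nz.
  - rewrite SL2Z_det by exact Hg. field. repeat split; auto using Ci_nz.
Qed.

Lemma C_is_derive_affine (a b z : C) : C_is_derive (fun w => a * w + b)%C z a.
Proof.
  assert (H := C_is_derive_plus _ _ z _ _
    (C_is_derive_mult _ _ z _ _ (C_is_derive_const a z) (C_is_derive_id z))
    (C_is_derive_const b z)).
  cbv beta in H.
  replace (RtoC 0 * z + a * RtoC 1 + RtoC 0)%C with a in H by ring. exact H.
Qed.

Lemma C_is_derive_autom (g : mat2) (tau : C) :
  C_is_derive (autom g) tau (RtoC (IZR (mc g))).
Proof. apply C_is_derive_affine. Qed.

Lemma C_is_derive_moebius (g : mat2) (tau : C) : SL2Z g -> upper tau ->
  C_is_derive (moebius g) tau (/ (autom g tau * autom g tau))%C.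
Proof.
  intros Hg Ht. assert (HJ := autom_neq_0 g tau Hg Ht).
  assert (H := C_is_derive_div _ _ tau _ _
    (C_is_derive_affine (RtoC (IZR (ma g))) (RtoC (IZR (mb g))) tau)
    (C_is_derive_autom g tau) HJ).
  cbv beta in H.
  replace (/ (autom g tau * autom g tau))%C with
    ((RtoC (IZR (ma g)) * autom g tau -
      (RtoC (IZR (ma g)) * tau + RtoC (IZR (mb g))) * RtoC (IZR (mc g)))
     / (autom g tau * autom g tau))%C; [exact H|].
  (* Writing the numerator 1 as [ad - bc] reduces the claim to a polynomial identity. *)
  rewrite <- (Cmult_1_l (/ _)%C), <- (SL2Z_det g Hg). unfold Cdiv. f_equal.
  unfold autom. ring.
Qed.

Lemma modular_law_derive (k : Z) (G : mat2 -> Prop) (f : C -> C) (g : mat2) (tau : C) :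
  modular_law (holomorphic_at f) k G f -> G g -> SL2Z g -> upper tau ->
  holomorphic_at f tau -> holomorphic_at f (moebius g tau) ->
  C_derive f (moebius g tau) =
    (autom g tau * autom g tau *
      (RtoC (IZR k) * CpowZ (autom g tau) k / autom g tau * RtoC (IZR (mc g)) * f tau
       + CpowZ (autom g tau) k * C_derive f tau))%C.
Proof.
  intros Hf HG Hg Ht H1 H2. assert (HJ := autom_neq_0 g tau Hg Ht).
  assert (Hm := C_is_derive_moebius g tau Hg Ht).
  assert (Hc := C_ex_derive_filterlim (moebius g) tau (ex_intro _ _ Hm)).
  (* The law may be differentiated because it holds on a whole neighbourhood: [holomorphic_at] is an
     open condition, at [tau] directly and at [moebius g tau] by pulling back along the continuous
     map [moebius g]. *)
  assert (E : C_locally tau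
    (fun w => CpowZ (autom g w) k * f w = f (moebius g w))%C).
  { generalize (C_locally_and _ _ _ (upper_open tau Ht)
      (C_locally_and _ _ _ (locally_locally _ _ H1)
         (Hc _ (locally_locally _ _ H2)))).
    apply C_locally_imp. intros w (W1 & W2 & W3). symmetry. now apply Hf. }
  assert (D1 := C_is_derive_comp f (moebius g) tau _ _
    (C_ex_derive_correct f _ (locally_singleton _ _ H2)) Hm).
  assert (D2 := C_is_derive_mult _ _ tau _ _
    (C_is_derive_powZ (autom g) tau _ k (C_is_derive_autom g tau) HJ)
    (C_ex_derive_correct f _ (locally_singleton _ _ H1))).
  apply (C_is_derive_ext_loc _ _ _ _ E) in D2.
  assert (U := C_is_derive_unique _ _ _ _ D1 D2). rewrite <- U.
  field. exact HJ.
Qed.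

Lemma two_pi_i_neq_0 : (RtoC 2 * RtoC PI * Ci)%C <> RtoC 0.
Proof.
  repeat apply Cmult_neq_0; [| |exact Ci_nz]; apply RtoC_neq_0; [lra|apply PI_neq0].
Qed.

Lemma Gstar_modular (k : Z) (G1 G2 : mat2 -> Prop) (F h : C -> C) :
  (forall g, G1 g -> SL2Z g) ->
  modular_law (holomorphic_at F) k G1 F -> modular_law (holomorphic_at h) 0 G2 h ->
  modular_law (Gstar_defined F h) 0 (fun g => G1 g /\ G2 g) (Gstar k F h).
Proof.
  intros HG HF Hh g tau [Hg1 Hg2] Ht (F1 & h1 & F01 & h01 & dh1) (F2 & h2 & F02 & h02 & dh2).
  assert (Hg := HG g Hg1). assert (HJ := autom_neq_0 g tau Hg Ht).
  assert (HJ' : Cconj (autom g tau) <> RtoC 0).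
  { apply Cmod_gt_0. rewrite Cmod_conj. apply Cmod_gt_0, HJ. }
  assert (HP := CpowZ_neq_0 _ k HJ).
  assert (DF := modular_law_derive k G1 F g tau HF Hg1 Hg Ht F1 F2).
  assert (Dh := modular_law_derive 0 G2 h g tau Hh Hg2 Hg Ht h1 h2).
  assert (EF := HF g tau Hg1 Ht F1 F2). assert (Eh := Hh g tau Hg2 Ht h1 h2).
  assert (EI := Im_moebius g tau Hg Ht).
  assert (Ec : Cconj (autom g tau) =
    (autom g tau - RtoC 2 * Ci * RtoC (IZR (mc g)) * RtoC (Im tau))%C).
  { rewrite im_alt. unfold autom. rewrite Cplus_conj, Cmult_conj, !Cconj_RtoC. field.
    exact Ci_nz. }
  assert (Hpi : RtoC PI <> RtoC 0) by (apply RtoC_neq_0, PI_neq0).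
  assert (H2 : RtoC 2 <> RtoC 0) by (apply RtoC_neq_0; lra).
  assert (H4 : RtoC 4 = (RtoC 2 * RtoC 2)%C)
    by (rewrite <- RtoC_mult; f_equal; ring).
  assert (HI : RtoC (Im tau) <> RtoC 0)
    by (apply RtoC_neq_0; unfold upper in Ht; lra).
  assert (Hdh : C_derive h tau <> RtoC 0).
  { intros E. apply dh1. unfold Dop. rewrite E. unfold Cdiv. ring. }
  unfold Gstar, dlog, Dop. rewrite DF, Dh, EF, Eh, EI, H4.
  replace (CpowZ (autom g tau) 0) with (RtoC 1) by reflexivity.
  (* The conjugate of J = c tau + d is J - 2 i c y; every other conjugate has
     disappeared, so this turns the claim into a rational identity modulo i^2 = -1. *)
  set (c := RtoC (IZR (mc g))) in *. set (y := RtoC (Im tau)) in *.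
  set (J := autom g tau) in *. set (P := CpowZ J k) in *.
  set (dF := C_derive F tau) in *. set (d := C_derive h tau) in *.
  rewrite Ec in *.
  assert (HCi : (Ci * Ci)%C = (- RtoC 1)%C) by (unfold Ci, Cmult, Copp, RtoC; simpl; f_equal; ring).
  assert (Hi := Ci_nz).
  (* [field] treats [Ci] as a free variable, so the two sides differ by this explicit multiple of
     [Ci * Ci + 1], which is zero. *)
  match goal with |- ?u = ?v => replace u with (v + RtoC (IZR k) * h tau * c
     / (J * d) * (Ci * Ci + RtoC 1))%C end; [rewrite HCi; ring|].
  field. repeat split; auto.
Qed.

(** * The function G^* *)

(** A real increment leaves [Im] fixed, forcing [|l| <= 1/4]; an increment [i t] changes it by [t],
    forcing [|1 - i l| <= 1/4]. Then [1 <= 1/2]. *)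
Lemma Im_not_C_ex_derive (z : C) : ~ C_ex_derive (fun w => RtoC (Im w)) z.
Proof.
  intros [l Hl].
  destruct (proj1 (C_locally_Cmod _ _)
    (proj1 (C_is_derive_Cmod _ z l) Hl (mkposreal (1 / 4) ltac:(lra)))) as [d Hd].
  cbn [pos] in Hd. assert (Hd0 := cond_pos d). set (t := d / 2).
  assert (Et : Cmod (RtoC t) = t) by (rewrite Cmod_R; apply Rabs_pos_eq; unfold t; lra).
  assert (Ei : Cmod (RtoC t * Ci) = t) by (rewrite Cmod_mult, Cmod_Ci, Et; ring).
  assert (E1 : (z + RtoC t - z)%C = RtoC t) by ring.
  assert (E2 : (z + RtoC t * Ci - z)%C = (RtoC t * Ci)%C) by ring.
  assert (H1 := Hd (z + RtoC t)%C). assert (H2 := Hd (z + RtoC t * Ci)%C).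
  rewrite E1, Et in H1. rewrite E2, Ei in H2.
  specialize (H1 ltac:(unfold t; lra)). specialize (H2 ltac:(unfold t; lra)).
  replace (RtoC (Im (z + RtoC t)) - RtoC (Im z) - RtoC t * l)%C
    with (- (RtoC t * l))%C in H1.
  2: { replace (Im (z + RtoC t)) with (Im z) by (unfold Im; simpl; ring). ring. }
  replace (RtoC (Im (z + RtoC t * Ci)) - RtoC (Im z) - RtoC t * Ci * l)%C
    with (RtoC t - RtoC t * Ci * l)%C in H2.
  2: { replace (Im (z + RtoC t * Ci)) with (Im z + t) by (unfold Im; simpl; ring).
       rewrite RtoC_plus. ring. }
  assert (H := Cmod_triangle (RtoC t - RtoC t * Ci * l) (RtoC t * Ci * l)).
  replace (RtoC t - RtoC t * Ci * l + RtoC t * Ci * l)%C with (RtoC t) in H by ring.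
  rewrite Cmod_opp, Cmod_mult, Et in H1.
  rewrite (Cmod_mult _ l), Ei, Et in H. unfold t in *. lra.
Qed.

(** The numerator [Dop f] is already a derivative, so the second derivative obtained from the
    Laurent expansion is what makes the quotient rule applicable. *)
Lemma dlog_C_ex_derive (f : C -> C) (z : C) :
  meromorphic_at f z -> holomorphic_at f z -> f z <> RtoC 0 ->
  C_ex_derive (dlog f) z.
Proof.
  intros Hm Hf H0. destruct (meromorphic_ex_derive2 f z Hm Hf) as [d2 H2].
  eexists. apply (C_is_derive_div (Dop f) f).
  - apply (C_is_derive_div (C_derive f) (fun _ => (RtoC 2 * RtoC PI * Ci)%C)).
    + exact H2.
    + apply C_is_derive_const.
    + exact two_pi_i_neq_0.
  - apply C_ex_derive_correct, (locally_singleton _ _ Hf).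
  - exact H0.
Qed.

Lemma Gstar_not_holomorphic (k : Z) (F h : C -> C) (tau : C) :
  k <> 0%Z -> upper tau -> meromorphic_at F tau -> meromorphic_at h tau ->
  Gstar_defined F h tau -> ~ holomorphic_at (Gstar k F h) tau.
Proof.
  intros Hk Ht MF Mh (HF & Hh & F0 & h0 & dh0) HG.
  apply (Im_not_C_ex_derive tau).
  destruct (dlog_C_ex_derive F tau MF HF F0) as [dF DF].
  destruct (dlog_C_ex_derive h tau Mh Hh h0) as [dh Dh].
  destruct (locally_singleton _ _ HG) as [dG DG].
  assert (Hl0 : dlog h tau <> RtoC 0).
  { unfold dlog. apply Cmult_neq_0; [exact dh0 | apply Cinv_neq_0, h0]. }
  assert (Hk' : RtoC (IZR k) <> RtoC 0) by (apply RtoC_neq_0, not_0_IZR, Hk).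
  assert (Hpi : RtoC PI <> RtoC 0) by (apply RtoC_neq_0, PI_neq0).
  assert (H4 : RtoC 4 <> RtoC 0) by (apply RtoC_neq_0; lra).
  (* [A] isolates the nonholomorphic term [c / (Im w * dlog h w)], so [Im w = c / (A w * dlog h w)];
     if [Gstar] were differentiable, so would be [A]. *)
  set (A := fun w => (dlog F w / dlog h w - Gstar k F h w)%C).
  set (c := (RtoC (IZR k) / (RtoC 4 * RtoC PI))%C).
  assert (EA : forall w, upper w -> dlog h w <> RtoC 0 ->
    A w = (c / (RtoC (Im w) * dlog h w))%C).
  { intros w Hw Hlw. unfold A, Gstar, c.
    assert (HI : RtoC (Im w) <> RtoC 0)
      by (apply RtoC_neq_0; unfold upper in Hw; lra).
    field. repeat split; assumption. }
  (* Here [k <> 0] enters: it makes [A * dlog h] nonzero at [tau], so that one may divide by it. *)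
  assert (Hc : c <> RtoC 0).
  { apply Cmult_neq_0; [exact Hk'|]. apply Cinv_neq_0, Cmult_neq_0; assumption. }
  assert (HIt : RtoC (Im tau) <> RtoC 0)
    by (apply RtoC_neq_0; unfold upper in Ht; lra).
  assert (HA0 : (A tau * dlog h tau)%C <> RtoC 0).
  { rewrite (EA tau Ht Hl0). apply Cmult_neq_0; [|exact Hl0].
    apply Cmult_neq_0; [exact Hc|]. apply Cinv_neq_0, Cmult_neq_0; assumption. }
  assert (DA := C_is_derive_minus _ _ tau _ _ (C_is_derive_div _ _ tau _ _ DF Dh Hl0) DG).
  assert (DI := C_is_derive_div _ _ tau _ _ (C_is_derive_const c tau)
                  (C_is_derive_mult A (dlog h) tau _ _ DA Dh) HA0).
  eexists. refine (C_is_derive_ext_loc _ _ _ _ _ DI).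
  generalize (C_locally_and _ _ _ (upper_open tau Ht)
    (C_filterlim_neq (dlog h) tau _ (C_ex_derive_filterlim _ _ (ex_intro _ _ Dh)) Hl0)).
  apply C_locally_imp. intros w [Hw Hlw]. rewrite (EA w Hw Hlw).
  assert (HI : RtoC (Im w) <> RtoC 0)
    by (apply RtoC_neq_0; unfold upper in Hw; lra).
  field. repeat split; assumption.
Qed.

(** * The series for 1/pi *)

Lemma C_exists_larger_Cmod (h : C -> C) (z dh : C) (P : C -> Prop) :
  C_is_derive h z dh -> dh <> RtoC 0 -> h z <> RtoC 0 -> C_locally z P ->
  exists w, P w /\ Cmod (h z) < Cmod (h w).
Proof.
  intros Hh Hd H0 HP.
  assert (Hd' := proj1 (Cmod_gt_0 dh) Hd). assert (H0' := proj1 (Cmod_gt_0 (h z)) H0).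
  (* With this precision the error at [w] is at most [t |h z| / 2], half of the first-order gain
     [t |h z|]. *)
  assert (He : 0 < Cmod dh / 2) by lra.
  destruct (proj1 (C_locally_Cmod _ _) (C_locally_and _ _ _ HP
    (proj1 (C_is_derive_Cmod h z dh) Hh (mkposreal _ He)))) as [d Hdd].
  cbn [pos] in Hdd. assert (Hd0 := cond_pos d).
  set (s := Cmod (h z) / Cmod dh).
  assert (Hs : 0 < s) by (apply Rdiv_lt_0_compat; assumption).
  (* Chosen so that [|w - z| = t s = d/2], inside the disc of radius [d]. *)
  set (t := d / (2 * s)). assert (Ht : 0 < t) by (apply Rdiv_lt_0_compat; lra).
  (* In the direction h(z)/h'(z), to first order h(z) is multiplied by 1 + t. *)
  set (w := (z + RtoC t * (h z / dh))%C).
  assert (Ew : (w - z)%C = (RtoC t * (h z / dh))%C) by (unfold w; ring).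
  assert (Em : Cmod (w - z) = t * s).
  { rewrite Ew, Cmod_mult, Cmod_R, Cmod_div by exact Hd.
    rewrite (Rabs_pos_eq t) by lra. reflexivity. }
  destruct (Hdd w) as [Pw Hw].
  { rewrite Em. unfold t. replace (d / (2 * s) * s) with (d / 2) by (field; lra). lra. }
  exists w. split; [exact Pw|].
  rewrite Em, Ew in Hw.
  assert (H := Cmod_triangle (h w) (- (h w - h z - RtoC t * (h z / dh) * dh))).
  rewrite Cmod_opp in H.
  replace (h w + - (h w - h z - RtoC t * (h z / dh) * dh))%C
    with (RtoC (1 + t) * h z)%C in H by (rewrite RtoC_plus; field; exact Hd).
  rewrite Cmod_mult, Cmod_R, (Rabs_pos_eq (1 + t)) in H by lra.
  replace (Cmod dh / 2 * (t * s)) with (t * Cmod (h z) / 2) in Hw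
    by (unfold s; field; lra).
  assert (0 < t * Cmod (h z)) by (apply Rmult_lt_0_compat; assumption). lra.
Qed.

Lemma Gstar_series (k : Z) (F h : C -> C) (u : nat -> C) (tau : C) :
  C_locally tau (fun w => C_is_series (fun n => u n * h w ^ n)%C (F w)) ->
  upper tau -> Gstar_defined F h tau ->
  C_is_series (fun n => (RtoC (INR n) - Gstar k F h tau) * u n * h tau ^ n)%C
    (RtoC (IZR k) / (RtoC 4 * RtoC PI * RtoC (Im tau)) * (F tau / dlog h tau))%C.
Proof.
  intros Hexp Ht (HF & Hh & F0 & h0 & dh0).
  assert (Hexp' : C_locally tau (fun w => C_is_pseries u (h w) (F w))).
  { revert Hexp. apply C_locally_imp. intros w. apply C_is_pseries_series. }
  assert (Dh := C_ex_derive_correct h tau (locally_singleton _ _ Hh)).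
  assert (Hdh : C_derive h tau <> RtoC 0).
  { intros E. apply dh0. unfold Dop. rewrite E. unfold Cdiv. ring. }
  destruct (C_exists_larger_Cmod h tau _ _ Dh Hdh h0 Hexp') as (w & Pw & Hw).
  destruct (C_is_derive_pseries_comp u _ _ h F tau _ Pw Hw Dh Hexp') as (L & HL & DF).
  apply is_C_derive_unique in DF.
  assert (HnL : C_is_series (fun n => RtoC (INR n) * u n * h tau ^ n)%C (h tau * L)%C).
  { apply C_is_pseries_series.
    refine (is_pseries_ext (V := C_NormedModule) _ _ _ _ _
             (is_pseries_incr_1 (V := C_NormedModule) _ _ _ HL)).
    (* Multiplication by [h tau] shifts the derived series and puts 0 at index 0, which agrees with
       [INR 0 * u 0]. *)
    intros [|n]; simpl PS_incr_1; [|reflexivity].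
    symmetry. apply Cmult_0_l. }
  assert (H := is_series_minus (V := C_NormedModule) _ _ _ _ HnL
    (is_series_scal (V := C_NormedModule) (Gstar k F h tau) _ _
      (locally_singleton _ _ Hexp))).
  assert (E : (RtoC (IZR k) / (RtoC 4 * RtoC PI * RtoC (Im tau)) * (F tau / dlog h tau))%C
    = (h tau * L + - (Gstar k F h tau * F tau))%C).
  { unfold Gstar, dlog, Dop. rewrite DF.
    assert (Hpi : RtoC PI <> RtoC 0) by (apply RtoC_neq_0, PI_neq0).
    assert (Hi := Ci_nz).
    assert (HI : RtoC (Im tau) <> RtoC 0)
      by (apply RtoC_neq_0; unfold upper in Ht; lra).
    field. repeat split; assumption. }
  rewrite E. revert H.
  apply (is_series_ext (V := C_NormedModule)). intros n.
  assert (R : forall a b c g : C, (a * b * c + - (g * (b * c)) = (a - g) * b * c)%C)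
    by (intros; ring).
  exact (R (RtoC (INR n)) (u n) (h tau ^ n)%C (Gstar k F h tau)).
Qed.

Theorem proposition2p1
  (k : Z) (G1 G2 : mat2 -> Prop) (F h : C -> C) (u : nat -> C) (Y : R)
  (hG1 : congruence_subgroup G1) (hF : modular_function k G1 F)
  (hG2 : congruence_subgroup G2) (hh : modular_function 0 G2 h)
  (hu : polynomial_recurrence u)
  (hexp : forall tau : C, upper tau -> (Y < Im tau)%R ->
     is_series (K := C_AbsRing) (V := C_NormedModule)
       (fun n : nat => u n * h tau ^ n)%C (F tau)) :
  modular_law (Gstar_defined F h) 0 (fun g => G1 g /\ G2 g) (Gstar k F h) /\
  (k <> 0%Z -> forall tau : C, upper tau -> Gstar_defined F h tau ->
     ~ holomorphic_at (Gstar k F h) tau) /\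
  (forall tau : C, upper tau -> (Y < Im tau)%R -> Gstar_defined F h tau ->
     is_series (K := C_AbsRing) (V := C_NormedModule)
       (fun n : nat => (RtoC (INR n) - Gstar k F h tau) * u n * h tau ^ n)%C
       (RtoC (IZR k) / (RtoC 4 * RtoC PI * RtoC (Im tau))
        * (F tau / dlog h tau))%C).
Proof.
  split; [|split].
  - apply Gstar_modular.
    + exact (congr_SL2Z _ hG1).
    + exact (modular_transform _ _ _ hF).
    + exact (modular_transform _ _ _ hh).
  - intros Hk tau Ht. apply Gstar_not_holomorphic; [exact Hk | exact Ht | |].
    + exact (modular_meromorphic _ _ _ hF tau Ht).
    + exact (modular_meromorphic _ _ _ hh tau Ht).
  - intros tau Ht HY. apply Gstar_series; [|exact Ht].
    (* The half-plane where the expansion is given is open, so it holds near [tau], as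
       differentiation requires. *)
    generalize (C_locally_and _ _ _ (upper_open tau Ht) (Im_gt_open tau Y HY)).
    apply C_locally_imp. intros w [Hw HwY]. now apply hexp.
Qed.
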